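(* Let $\mathcal{G}=(V,T,P,s)$ be a proper context-free grammar. Then the restriction of the map $\mathrm{in}$, sending any $(a,u)\in\mathbf{Bud}_{V\sqcup T}(\mathbf{As})$ to $u$, to the domain $\mathrm{L}(\mathrm{CFG}(\mathcal{G}))$ is a bijection between $\mathrm{L}(\mathrm{CFG}(\mathcal{G}))$ and the language of $\mathcal{G}$.
   Context: Context-free grammars. A context-free grammar is a tuple $\mathcal{G}=(V,T,P,s)$ where $V$ is a finite alphabet of variables, $T$ is a finite alphabet of terminal symbols (disjoint from $V$), $P$ is a finite subset of $V\times(V\sqcup T)^*$ (the productions), and $s\in V$ is the start symbol. For $x_1,x_2\in(V\sqcup T)^*$, $x_2$ is derivable in one step from $x_1$ if $x_1=u\,a\,v$ and $x_2=u\,w\,v$ with $u,v\in(V\sqcup T)^*$ and $(a,w)\in P$; derivability is the reflexive and transitive closure. The language of $\mathcal{G}$ is the set of all words $x\in T^*$ derivable from the one-letter word $s$. $\mathcal{G}$ is proper if $w$ is not the empty word for every $(a,w)\in P$. The colored operad. For a finite set $\mathscr{C}$ of colors, $\mathbf{Bud}_{\mathscr{C}}(\mathbf{As})$ (the bud operad of the associative operad $\mathbf{As}$, which has exactly one element in each arity $n\geq 1$) is the set of all pairs $(a,u)$ with $a\in\mathscr{C}$ and $u$ a nonempty word on $\mathscr{C}$; the output color of $(a,u)$ is $a$, its word of input colors is $\mathrm{in}((a,u))=u$, and its arity is the length $|u|$. The partial composition $(a,u)\circ_i(b,v)$, $1\leq i\leq|u|$, is defined if and only if $b=u_i$, and is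 then $(a,u')$ where $u'$ is obtained from $u$ by replacing its $i$-th letter by the word $v$. The unit of color $a$ is $\mathbf{1}_a=(a,a)$. Bud generating systems. A bud generating system with ground operad $\mathbf{As}$ is a tuple $\mathcal{B}=(\mathbf{As},\mathscr{C},\mathfrak{R},I,T)$ where $\mathscr{C}$ is a finite set of colors, $\mathfrak{R}$ is a finite subset of $\mathbf{Bud}_{\mathscr{C}}(\mathbf{As})$ (the rules), and $I,T\subseteq\mathscr{C}$ (initial and terminal colors). Write $x_1\to x_2$ if $x_2=x_1\circ_i r$ for some $r\in\mathfrak{R}$ and some $i$. The language $\mathrm{L}(\mathcal{B})$ is the set of all $x\in\mathbf{Bud}_{\mathscr{C}}(\mathbf{As})$ such that, for some $a\in I$, $x$ is obtained from $\mathbf{1}_a$ by a finite (possibly empty) sequence of steps $\to$, and all input colors of $x$ are in $T$. The construction. For a proper context-free grammar $\mathcal{G}=(V,T,P,s)$, $\mathrm{CFG}(\mathcal{G})$ is the bud generating system $(\mathbf{As},V\sqcup T,\mathfrak{R},\{s\},T)$ with $\mathfrak{R}=\{(a,u)\in\mathbf{Bud}_{V\sqcup T}(\mathbf{As}):(a,u)\in P\}$. *)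

(* Defs.v *)
From HB Require Import structures.
From Stdlib Require Import Relation_Operators.
From mathcomp Require Import all_boot finmap classical_sets functions.

Set Implicit Arguments.
Unset Strict Implicit.
Unset Printing Implicit Defensive.

Local Open Scope fset_scope.
Local Open Scope classical_set_scope.

(* The disjoint union of the alphabets is the sum type V + T: a variable is
   read as inl a and a terminal symbol as inr t. *)
Record cfg (V T : finType) := Cfg {
  cfg_prods : {fset (V * seq (V + T))%type};
  cfg_start : V
}.

Section Grammar.
Variables (V T : finType) (G : cfg V T).

Definition cfg_step (x1 x2 : seq (V + T)) : Prop :=
  exists (u v w : seq (V + T)) (a : V),
    [/\ (a, w) \in cfg_prods G, x1 = u ++ inl a :: v & x2 = u ++ w ++ v].

Definition cfg_derives : seq (V + T) -> seq (V + T) -> Prop :=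
  clos_refl_trans _ cfg_step.

Definition terminal_word : seq T -> seq (V + T) := map inr.

Definition cfg_language : set (seq T) :=
  [set x | cfg_derives [:: inl (cfg_start G)] (terminal_word x)].

Definition cfg_proper : Prop :=
  forall (a : V) (w : seq (V + T)), (a, w) \in cfg_prods G -> w <> [::].

End Grammar.

Arguments terminal_word V {T} _.

(* As has exactly one element in each arity, so an element of Bud_C(As) is
   determined by its output color and its nonempty word of input colors. *)
Definition budAs (C : finType) : choiceType :=
  {x : (C * seq C)%type | x.2 != [::]}.

Section Operad.
Variable C : finType.
Implicit Types x y : budAs C.

Definition bud_out x : C := (val x).1.
Definition bud_in x : seq C := (val x).2.
Definition bud_arity x : nat := size (bud_in x).

Definition bud_unit (a : C) : budAs C :=
  exist (fun x : C * seq C => x.2 != [::]) (a, [:: a]) isT.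

(* u with its letter at position i (counted from 0) replaced by the word v *)
Definition subst_letter (u : seq C) (i : nat) (v : seq C) : seq C :=
  take i u ++ v ++ drop i.+1 u.

Lemma subst_letter_neq0 (u : seq C) i (v : seq C) :
  v != [::] -> subst_letter u i v != [::].
Proof. by rewrite /subst_letter; case: take => //; case: v. Qed.

(* None when the partial composition is undefined; positions are counted
   from 0, so index i here is index i + 1 in the usual operadic convention. *)
Definition bud_comp x (i : 'I_(bud_arity x)) y : option (budAs C) :=
  if bud_out y == tnth (in_tuple (bud_in x)) i then
    Some (exist (fun z : C * seq C => z.2 != [::])
      (bud_out x, subst_letter (bud_in x) i (bud_in y))
      (subst_letter_neq0 (bud_in x) i (valP y)))
  else None.

End Operad.

Record bud_system (C : finType) := BudSystem {
  bs_rules : {fset budAs C};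
  bs_initial : {set C};
  bs_terminal : {set C}
}.

Section BudSystem.
Variables (C : finType) (B : bud_system C).

Definition bs_step (x1 x2 : budAs C) : Prop :=
  exists (r : budAs C) (i : 'I_(bud_arity x1)),
    r \in bs_rules B /\ bud_comp i r = Some x2.

Definition bs_derives : budAs C -> budAs C -> Prop :=
  clos_refl_trans _ bs_step.

Definition bs_language : set (budAs C) :=
  [set x | (exists2 a, a \in bs_initial B & bs_derives (bud_unit a) x) /\
           (forall c, c \in bud_in x -> c \in bs_terminal B)].

End BudSystem.

Section Construction.
Variables (V T : finType) (G : cfg V T).

(* insub discards the productions (a, w) with w empty, which are not elements
   of Bud(As); mem_cfg_rules characterizes the resulting finite set. *)
Definition cfg_rules : {fset budAs (V + T)%type} :=
  [fset r in pmap (fun p : V * seq (V + T) =>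
                     insub (inl p.1 : (V + T)%type, p.2) : option (budAs (V + T)%type))
                  (cfg_prods G)].

Lemma mem_cfg_rules (r : budAs (V + T)%type) :
  r \in cfg_rules <->
  exists2 a : V, bud_out r = inl a & (a, bud_in r) \in cfg_prods G.
Proof.
rewrite in_fset /= mem_pmap; split.
  case/mapP=> -[a w] Paw /esym; case: insubP => // r' _ Er' [<-].
  by exists a; rewrite /bud_out /bud_in Er'.
case=> a ra Pa; apply/mapP; exists (a, bud_in r) => //=.
by rewrite -ra -[(_, _)]/((val r).1, (val r).2) -surjective_pairing valK.
Qed.

Definition bud_of_cfg : bud_system (V + T)%type :=
  {| bs_rules := cfg_rules;
     bs_initial := finset.set1 (inl (cfg_start G));
     bs_terminal := [set inr t | t : T]%SET |}.

End Construction.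

(* Main.v *)
Require Import Defs.
From Stdlib Require Import Relation_Operators.
From mathcomp Require Import all_boot finmap classical_sets functions.

(** Replacing the [i]-th letter of the input word of [x] by the input word of
    a rule is exactly a derivation step of the grammar, and it leaves the
    output color of [x] unchanged. Hence a derivation from the unit of color
    [s] is a derivation of the grammar from the one-letter word [s]: the input
    word follows the grammar while the output color stays equal to [s].

    - [cfg_step_of_bs_step] and [bs_step_of_cfg_step] compare single steps, and
      [cfg_derives_of_bs_derives] and [bs_derives_of_cfg_derives] compare
      derivations. The second direction uses that the grammar is proper: a
      production with an empty right-hand side is not an element of the operad.
    - [bs_derives_out] says that the output color is constant, so that an
      element of the language is [(s, u)], determined by its input word [u].
      This gives injectivity.
    - [terminal_wordP] identifies the words whose letters are all terminal
      colors with the words on [T]. *)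

Local Open Scope classical_set_scope.

Lemma eq_bud (C : finType) (x y : budAs C) :
  bud_out x = bud_out y -> bud_in x = bud_in y -> x = y.
Proof.
rewrite /bud_out /bud_in => eq_out eq_in; apply: val_inj.
by rewrite [val x]surjective_pairing eq_out eq_in -surjective_pairing.
Qed.

Lemma bs_derives_out (C : finType) (B : bud_system C) (x y : budAs C) :
  bs_derives B x y -> bud_out y = bud_out x.
Proof.
elim=> {x y} [x y [r [i [_]]]||x y z _ -> _ ->] //.
by rewrite /bud_comp; case: ifP => // _ [<-].
Qed.

Lemma terminal_wordP (V T : finType) (u : seq (V + T)) :
  (forall c, c \in u -> c \in [set inr t | t : T]%SET) <->
  exists t, terminal_word V t = u.
Proof.
split=> [|[t <-] _ /mapP[a _ ->]]; last exact: imset_f.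
elim: u => [|c u IHu] termu; first by exists [::].
have /imsetP[a _ ->] := termu c (mem_head c u).
have [d ud|t <-] := IHu; first by apply: termu; rewrite inE ud orbT.
by exists (a :: t).
Qed.

Section Derivations.
Variables (V T : finType) (G : cfg V T).
Implicit Types x y : budAs (V + T)%type.

Lemma cfg_step_of_bs_step x y :
  bs_step (bud_of_cfg G) x y -> cfg_step G (bud_in x) (bud_in y).
Proof.
case=> r [i [/mem_cfg_rules[a out_r Pr]]].
rewrite /bud_comp; case: eqP => // eq_out [<-].
exists (take i (bud_in x)), (drop i.+1 (bud_in x)), (bud_in r), a.
split=> //; rewrite -out_r eq_out (tnth_nth (bud_out x)) /=.
by rewrite -drop_nth // cat_take_drop.
Qed.

Lemma bs_step_of_cfg_step x w :
    cfg_proper G -> cfg_step G (bud_in x) w ->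
  exists2 y, bs_step (bud_of_cfg G) x y & bud_in y = w.
Proof.
move=> hG [u [v [p [a [Pap in_x ->]]]]].
have p_neq0 : p != [::] by apply/eqP/(hG a).
pose r : budAs (V + T)%type :=
  exist (fun z : (V + T) * seq (V + T) => z.2 != [::]) (inl a, p) p_neq0.
have lt_u : size u < bud_arity x.
  by rewrite /bud_arity in_x size_cat /= addnS ltnS leq_addr.
have rule_r : r \in bs_rules (bud_of_cfg G).
  by apply/mem_cfg_rules; exists a.
have out_r : bud_out r = tnth (in_tuple (bud_in x)) (Ordinal lt_u).
  by rewrite (tnth_nth (bud_out x)) /= in_x nth_cat ltnn subnn.
exists (exist (fun z : (V + T) * seq (V + T) => z.2 != [::])
         (bud_out x, subst_letter (bud_in x) (size u) p)
         (subst_letter_neq0 (bud_in x) (size u) p_neq0)).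
  exists r, (Ordinal lt_u); split=> //.
  rewrite /bud_comp out_r eqxx; congr Some; exact: val_inj.
rewrite -[bud_in _]/(subst_letter (bud_in x) (size u) p) in_x /subst_letter.
by rewrite take_size_cat // -cat_rcons drop_size_cat // size_rcons.
Qed.

Lemma cfg_derives_of_bs_derives x y :
  bs_derives (bud_of_cfg G) x y -> cfg_derives G (bud_in x) (bud_in y).
Proof.
elim=> {x y} [x y /cfg_step_of_bs_step|x|x y z _ xy _ yz].
- exact: rt_step.
- exact: rt_refl.
- exact: rt_trans xy yz.
Qed.

Lemma bs_derives_of_cfg_derives x w :
    cfg_proper G -> cfg_derives G (bud_in x) w ->
  exists2 y, bs_derives (bud_of_cfg G) x y & bud_in y = w.
Proof.
move=> hG; move: {-2}(bud_in x) (erefl (bud_in x)) => u in_x duw.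
elim: duw x in_x => {u w} [u w step_uw|u|u v w _ IHuv _ IHvw] x in_x.
- rewrite in_x in step_uw.
  have [y xy in_y] := bs_step_of_cfg_step _ _ hG step_uw.
  by exists y => //; apply: rt_step.
- by exists x => //; apply: rt_refl.
- have [y xy in_y] := IHuv x in_x; have [z yz in_z] := IHvw y (esym in_y).
  by exists z => //; apply: rt_trans xy yz.
Qed.

End Derivations.

Theorem proposition2p3p1 (V T : finType) (G : cfg V T) (hG : cfg_proper G) :
  set_bij (bs_language (bud_of_cfg G))
          (terminal_word V @` cfg_language G)
          (@bud_in (V + T)%type).
Proof.
split=> [x [[a /set1P-> dx] /terminal_wordP[t in_x]]|x y|_ [t dt <-]].
- by exists t => //; rewrite /cfg_language /= in_x; apply: cfg_derives_of_bs_derives dx.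
- rewrite !in_setE => -[[a /set1P-> dx] _] [[b /set1P-> dy] _].
  by apply: eq_bud; rewrite (bs_derives_out _ _ _ _ dx) (bs_derives_out _ _ _ _ dy).
- have [x dx in_x] :=
    bs_derives_of_cfg_derives _ _ _ (bud_unit (inl (cfg_start G))) _ hG dt.
  exists x => //; split; first by exists (inl (cfg_start G)); rewrite ?set11.
  by apply/terminal_wordP; exists t.
Qed.
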